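(* Each Hausdorff locally separable saturated first countable paratopological group has a suitable set. Each Hausdorff locally separable saturated first countable non-precompact paratopological group has a closed suitable set.
   Context: A paratopological group is a group $G$ endowed with a topology such that the group operation $G\times G\to G$ is continuous (inversion need not be continuous). The identity is denoted by $e$. A subset $S$ of a paratopological group $G$ is a suitable set for $G$ if $S$ is a discrete subspace of $G$, $S\cup\{e\}$ is closed in $G$, and the subgroup $\langle S\rangle$ generated by $S$ is dense in $G$. A closed suitable set is a suitable set that is closed in $G$. A paratopological group $G$ is saturated if for each neighborhood $U$ of the identity of $G$, the inverse $U^{-1}$ has non-empty interior in $G$. It is precompact if for each neighborhood $U$ of the identity there exists a finite subset $F$ of $G$ such that $FU=G$. A space is locally separable if each of its points has a separable neighborhood. *)

(* Defs.v *)
From HB Require Import structures.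
From mathcomp Require Import all_boot all_classical topology.

Set Implicit Arguments.
Unset Strict Implicit.
Unset Printing Implicit Defensive.

Local Open Scope classical_set_scope.
Local Open Scope group_scope.

HB.structure Definition PreTopologicalGroup := {G of Topological G & Group G}.

HB.mixin Record PreTopologicalGroup_isParatopologicalGroup G
    & PreTopologicalGroup G := {
  mulg_continuous : continuous (fun x : G * G => x.1 * x.2)
}.

#[short(type="paratopologicalGroupType")]
HB.structure Definition ParatopologicalGroup :=
  {G of PreTopologicalGroup G & PreTopologicalGroup_isParatopologicalGroup G}.

Section TopologicalSpaces.
Context (T : topologicalType).

Definition first_countable_space :=
  forall x : T, exists2 B : set_system T, countable B & nbhs x = filter_from B id.

Definition separable_space := exists2 D : set T, countable D & dense D.

Definition discrete_space := forall A : set T, open A.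

End TopologicalSpaces.

(* [set_type S] carries the subspace topology, whereas the topology of the
   library's [subspace S] also has the points outside S, all isolated. *)
Definition discrete_subspace (T : topologicalType) (S : set T) :=
  discrete_space (set_type S).

Definition locally_separable_space (T : topologicalType) :=
  forall x : T, exists2 U : set T, nbhs x U & separable_space (set_type U).

Definition generated_subgroup (G : groupType) (S : set G) : set G :=
  smallest [set H : set G | group_closed [in H]] S.

Section ParatopologicalGroups.
Context (G : paratopologicalGroupType).

Definition saturated :=
  forall U : set G, nbhs 1 U -> [set x^-1 | x in U]° !=set0.

(* Not the library's [precompact], which means relatively compact. *)
Definition precompact_group :=
  forall U : set G, nbhs 1 U ->
    exists2 F : set G, finite_set F & [set x * u | x in F & u in U] = [set: G].

Definition suitable_set (S : set G) :=
  [/\ discrete_subspace S, closed (S `|` [set 1])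
    & dense (generated_subgroup S)].

Definition closed_suitable_set (S : set G) := suitable_set S /\ closed S.

End ParatopologicalGroups.

Arguments first_countable_space : clear implicits.
Arguments separable_space : clear implicits.
Arguments discrete_space : clear implicits.
Arguments saturated : clear implicits.
Arguments precompact_group : clear implicits.

(* Main.v *)
(** The sets containing some [V V^-1], with [V] a neighborhood of [1], form the
    neighborhoods of [1] in a coarser topology on [G], the "flat" topology. When
    [G] is saturated this is a group topology, Hausdorff and first countable if
    [G] is, and every nonempty open set of [G] has nonempty flat interior; hence
    flat-dense sets are dense, and [G] is precompact if it is flat-precompact.

    If [G] is flat-precompact with a decreasing countable base [Z 0 = G, Z 1,
    ...] of flat neighborhoods of [1], choose finite [F n] in [Z n] with [Z n]
    covered by [F n * Z n.+1]: their union converges to [1] and generates a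
    dense subgroup.

    Otherwise there are a sequence [x] and a flat neighborhood [W] of [1] such
    that each translate of [W] contains at most one [x n]. Local separability
    gives a countable [D], as close to [1] as needed, such that the flat closure
    [M] of the subgroup generated by [D] is open. For a transversal [T] of the
    left cosets of [M] and an injective numbering [i] of [D], the union of [T],
    of the range of [x] and of [{x (i d) * d | d in D}] is closed discrete and
    generates a dense subgroup. *)
Require Import Defs.
From HB Require Import structures.
From mathcomp Require Import all_boot all_classical topology.

Set Implicit Arguments.
Unset Strict Implicit.
Unset Printing Implicit Defensive.

(** * Locally finite sets in T1 spaces *)

Section Discreteness.
Context (T : topologicalType).
Local Open Scope classical_set_scope.
Implicit Types S : set T.

Definition locally_finite_at S (y : T) :=
  exists2 N, nbhs y N & finite_set (N `&` S).

(** The finitely many points of [S] in [N] other than [y] form a closed set, which can be removed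
    from the interior of [N]. *)
Lemma locally_finite_at_nbhs S y : accessible_space T ->
  locally_finite_at S y ->
  exists O, [/\ open O, O y & forall x, O x -> S x -> x = y].
Proof.
move=> T1 [N Ny fin]; set F := (N `&` S) `\ y.
have Fcl : closed F.
  by apply: (accessible_finite_set_closed.1 T1);
    apply: sub_finite_set fin => x [].
exists (N° `&` ~` F); split.
- by apply: openI; [exact: open_interior|exact: closed_openC].
- by split=> // -[_]; apply.
- move=> x [/interior_subset Nx nF] Sx; apply: contrapT => xy.
  by apply: nF.
Qed.

Lemma locally_finite_discrete S : accessible_space T ->
  (forall y, S y -> locally_finite_at S y) -> discrete_subspace S.
Proof.
move=> T1 fin A.
exists (\bigcup_(O in [set O | open O /\ set_val @^-1` O `<=` A]) O).
  by apply: bigcup_open => O [].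
apply/seteqP; split => [a [O [_ OA] Oa]|a Aa]; first exact: OA.
have [O [Oop Oa Oeq]] :=
  locally_finite_at_nbhs T1 (fin (set_val a) (set_mem (valP a))).
exists O => //; split=> // b Ob.
suff -> : b = a by [].
by apply: val_inj; apply: Oeq => //; exact: set_mem (valP b).
Qed.

Lemma locally_finite_closed S : accessible_space T ->
  (forall y, ~ S y -> locally_finite_at S y) -> closed S.
Proof.
move=> T1 fin; rewrite -openC openE => y /[dup] nSy /fin Fy.
have [O [Oop Oy Oeq]] := locally_finite_at_nbhs T1 Fy.
apply: (@filterS _ _ _ O); last exact: open_nbhs_nbhs.
by move=> x Ox Sx; apply: nSy; rewrite -(Oeq x).
Qed.

End Discreteness.

(** * Subgroups and transversals *)

Section Subgroups.
Context (G : groupType).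
Local Open Scope classical_set_scope.
Local Open Scope group_scope.
Implicit Types H : set G.

Lemma subgroup1 H : group_closed [in H] -> H 1.
Proof. by case=> /set_mem. Qed.

Lemma subgroupF H x y : group_closed [in H] -> H x -> H y -> H (x / y).
Proof.
by case=> _ HF Hx Hy; apply: set_mem; apply: HF; exact: mem_set.
Qed.

Lemma subgroupV H x : group_closed [in H] -> H x -> H x^-1.
Proof. by move=> HH Hx; rewrite -div1g; apply: subgroupF => //; exact: subgroup1. Qed.

Lemma subgroupM H x y : group_closed [in H] -> H x -> H y -> H (x * y).
Proof. by move=> HH Hx Hy; rewrite -(invgK y); apply: subgroupF => //; exact: subgroupV. Qed.

Lemma group_closedP H :
  H 1 -> (forall x y, H x -> H y -> H (x / y)) -> group_closed [in H].
Proof.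
move=> H1 HF; split; first exact: mem_set.
by move=> x y /set_mem Hx /set_mem Hy; apply: mem_set; exact: HF.
Qed.

Lemma generated_subgroup_closed (S : set G) :
  group_closed [in generated_subgroup S].
Proof.
apply: group_closedP => [H [HH _]|x y Sx Sy H [HH SH]].
  exact: subgroup1.
by apply: subgroupF => //; [exact: Sx|exact: Sy].
Qed.

Lemma sub_generated_subgroup (S : set G) : S `<=` generated_subgroup S.
Proof. by move=> x Sx H [_]; apply. Qed.

Lemma generated_subgroup_sub (S H : set G) : group_closed [in H] ->
  S `<=` H -> generated_subgroup S `<=` H.
Proof. by move=> HH SH x; apply. Qed.

(** The representative [t g] is picked by [xget] from the coset [C g] as a set, so elements of the
    same coset get the same one. *)
Lemma transversal_exists H : group_closed [in H] -> exists T : set G,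
  (forall g, exists2 t, T t & H (t^-1 * g)) /\
  {in T &, forall t u, H (t^-1 * u) -> t = u}.
Proof.
move=> HH; pose C g := [set h | H (g^-1 * h)]; pose t g := xget 1 (C g).
have Ct g : H (g^-1 * t g).
  by apply: (@xgetI _ 1 (C g) g); rewrite /C/= mulVg; exact: subgroup1.
have tC g h : H (g^-1 * h) -> t g = t h.
  move=> gh; rewrite /t; congr xget; apply/seteqP; split => x; rewrite /C/= => xC.
    have -> : h^-1 * x = (g^-1 * h)^-1 * (g^-1 * x).
      by rewrite invgM invgK -mulgA mulVKg.
    by apply: subgroupM => //; exact: subgroupV.
  have -> : g^-1 * x = (g^-1 * h) * (h^-1 * x) by rewrite -mulgA mulVKg.
  exact: subgroupM.
exists (range t); split => [g|_ _ /set_mem[g _ <-] /set_mem[h _ <-] gh].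
  exists (t g); first by exists g.
  have -> : (t g)^-1 * g = (g^-1 * t g)^-1 by rewrite invgM invgK.
  exact: subgroupV.
apply: tC.
have -> : g^-1 * h = (g^-1 * t g) * ((t g)^-1 * t h) / (h^-1 * t h).
  by rewrite !invgM !invgK -!mulgA !(mulVKg, mulKg).
by apply: subgroupF => //; exact: subgroupM.
Qed.

End Subgroups.

(** * The flat topology *)

Section FlatTopology.
Context (G : paratopologicalGroupType).
Local Open Scope classical_set_scope.
Local Open Scope group_scope.
Implicit Types U V W H : set G.

Lemma nbhs_mulg (x y : G) U : nbhs (x * y) U ->
  exists A B, [/\ nbhs x A, nbhs y B & forall a b, A a -> B b -> U (a * b)].
Proof.
move=> /(@mulg_continuous G (x, y)) [[A B] /= [xA yB] AB].
by exists A, B; split => // a b Aa Bb; apply: (AB (a, b)).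
Qed.

Lemma nbhs_mull (g x : G) U : nbhs (g * x) U -> nbhs x [set z | U (g * z)].
Proof.
move=> /nbhs_mulg[A [B [gA xB AB]]]; apply: filterS xB => z Bz.
by apply: AB => //; exact: nbhs_singleton.
Qed.

Lemma nbhs_mulr (g x : G) U : nbhs (x * g) U -> nbhs x [set z | U (z * g)].
Proof.
move=> /nbhs_mulg[A [B [xA gB AB]]]; apply: filterS xA => z Az.
by apply: AB => //; exact: nbhs_singleton.
Qed.

Lemma nbhs1_sqr U : nbhs 1 U ->
  exists2 V, nbhs 1 V & forall x y, V x -> V y -> U (x * y).
Proof.
rewrite -{1}(mulg1 1) => /nbhs_mulg[A [B [A1 B1 AB]]].
exists (A `&` B); first exact: filterI.
by move=> x y [Ax _] [_ By]; exact: AB.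
Qed.

Definition flat_nbhs W :=
  exists2 V, nbhs 1 V & forall x y, V x -> V y -> W (x / y).

Lemma flat_nbhsT : flat_nbhs setT.
Proof. by exists setT => //; exact: filterT. Qed.

Lemma flat_nbhsS W W' : W `<=` W' -> flat_nbhs W -> flat_nbhs W'.
Proof. by move=> WW' [V V1 VW]; exists V => // x y Vx Vy; apply: WW'; exact: VW. Qed.

Lemma flat_nbhsI W W' : flat_nbhs W -> flat_nbhs W' -> flat_nbhs (W `&` W').
Proof.
move=> [V V1 VW] [V' V'1 VW']; exists (V `&` V'); first exact: filterI.
by move=> x y [Vx V'x] [Vy V'y]; split; [exact: VW|exact: VW'].
Qed.

Lemma flat_nbhs_nbhs W : flat_nbhs W -> nbhs 1 W.
Proof.
move=> [V V1 VW]; apply: filterS (V1) => x Vx; rewrite -(divg1 x).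
by apply: VW => //; exact: nbhs_singleton V1.
Qed.

Lemma flat_nbhs1 W : flat_nbhs W -> W 1.
Proof. by move=> /flat_nbhs_nbhs/nbhs_singleton. Qed.

Lemma flat_nbhs_translate W y : flat_nbhs W -> nbhs y [set x | W (y^-1 * x)].
Proof. by move=> Wf; apply: nbhs_mull; rewrite mulVg; exact: flat_nbhs_nbhs. Qed.

Lemma flat_nbhsV W : flat_nbhs W -> flat_nbhs [set x | W x^-1].
Proof.
by move=> [V V1 VW]; exists V => // x y Vx Vy /=; rewrite invgF; exact: VW.
Qed.

Lemma flat_nbhsJ g W : flat_nbhs W -> flat_nbhs [set x | W (g * x / g)].
Proof.
move=> [V V1 VW]; exists [set x | V (g * x / g)].
  suff : nbhs (g * 1) [set z | V (z / g)] by exact: nbhs_mull.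
  by apply: nbhs_mulr; rewrite mulg1 mulgV.
move=> x y Vx Vy /=.
have -> : g * (x / y) / g = (g * x / g) / (g * y / g).
  by rewrite !invgM !invgK -!mulgA mulKg.
exact: VW.
Qed.

Hypothesis Gsat : saturated G.

Lemma saturated_nbhs1 V : nbhs 1 V ->
  exists x : G, nbhs x [set y | V y^-1].
Proof.
move=> /Gsat[x Vx]; exists x; apply: filterS Vx => _ [y Vy <-] /=.
by rewrite invgK.
Qed.

(* By saturation [g * a] lies in [A^-1] for all [a] near [1]; writing
   [(a / b)^-1 * (c / d)] as [(b / (g * a)) / (d / (g * c))] swaps the sides on
   which the inverses occur. *)
Lemma flat_nbhsVM W : flat_nbhs W ->
  exists2 W', flat_nbhs W' & forall x y, W' x -> W' y -> W (x^-1 * y).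
Proof.
move=> [V V1 VW].
have [A A1 AV] := nbhs1_sqr V1.
have [g Ag] := saturated_nbhs1 A1.
pose B := [set y | A (g * y)^-1].
have B1 : nbhs 1 B.
  by apply: (@nbhs_mull g 1 [set y | A y^-1]); rewrite mulg1.
exists [set x | exists a b, [/\ (A `&` B) a, (A `&` B) b & x = a / b]].
  by exists (A `&` B) => [|a b Aa Ab]; [exact: filterI|exists a, b].
move=> _ _ [a [b [[Aa Ba] [Ab Bb] ->]]] [c [d [[Ac Bc] [Ad Bd] ->]]].
have -> : (a / b)^-1 * (c / d) = (b * (g * a)^-1) / (d * (g * c)^-1).
  by rewrite !invgM !invgK -!mulgA mulKg.
by apply: VW; apply: AV.
Qed.

Lemma flat_nbhsF W : flat_nbhs W ->
  exists2 W', flat_nbhs W' & forall x y, W' x -> W' y -> W (x / y).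
Proof.
move=> /flat_nbhsVM[W' /flat_nbhsV W'f W'W].
exists [set x | W' x^-1] => // x y Wx Wy.
by rewrite -{1}(invgK x); exact: W'W.
Qed.

(** If [y V V] lies in [U] and [V^-1] contains [g B], then [y a b^-1 g^-1] is in [U] for [a] in [V]
    and [b] in [B]. Conjugation by [g] moves the factor [g^-1] to the left. *)
Lemma nbhs_flat_nbhs (y : G) U : nbhs y U ->
  exists g, flat_nbhs [set w | U (g * w)].
Proof.
rewrite -(mulg1 y) => /nbhs_mull/nbhs1_sqr[V V1 VU].
have [g Vg] := saturated_nbhs1 V1.
pose B := [set z | V (g * z)^-1].
have B1 : nbhs 1 B.
  by apply: (@nbhs_mull g 1 [set y | V y^-1]); rewrite mulg1.
exists (y / g).
apply: (flat_nbhsS _ (flat_nbhsJ g^-1 (W := [set w | U (y * (w / g))]) _)).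
  by move=> w /=; rewrite invgK -!mulgA mulgV mulg1.
exists (V `&` B); first exact: filterI.
move=> a b [Va _] [_ Vb] /=.
by rewrite -mulgA -invgM; exact: VU.
Qed.

Lemma flat_nbhs_hausdorff (y : G) : hausdorff_space G -> y != 1 ->
  exists2 W, flat_nbhs W & ~ W y.
Proof.
rewrite open_hausdorff => T2 /T2[[A B]] /= [/set_mem Ay /set_mem B1].
move=> [Aop Bop /eqP AB0].
exists [set x | x != y]; last by rewrite /= eqxx.
(* If [y = a / b] with [a], [b] in this set, then [a = y * b] would lie in both [A] and [B]. *)
exists (B `&` [set z | A (y * z)]).
  apply: filterI; first exact: open_nbhs_nbhs.
  by apply: nbhs_mull; rewrite mulg1; exact: open_nbhs_nbhs.
move=> a b [Ba _] [_ Ab] /=; apply/eqP => aby.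
have : (A `&` B) a by split => //; move: Ab; rewrite /= -aby mulgVK.
by rewrite AB0.
Qed.

Lemma flat_countable_base : first_countable_space G ->
  exists Z : nat -> set G, [/\ Z 0 = setT, forall n, flat_nbhs (Z n) &
    forall W, flat_nbhs W -> exists n, forall m, n <= m -> Z m `<=` W].
Proof.
move=> /(_ 1)[B /countable_injP[f finj] nbhsB].
pose V n := [set x | forall b, B b -> f b = n -> b x].
have V1 n : nbhs 1 (V n).
  have [[b [Bb fb]]|nb] := pselect (exists b, B b /\ f b = n).
    have b1 : nbhs 1 b by rewrite nbhsB; exists b.
    apply: filterS b1 => x bx c Bc fc.
    by rewrite (finj c b) ?inE// fc fb.
  by apply: filterS filterT => x _ b Bb fb; case: nb; exists b.
pose W n := [set x | exists a b, [/\ V n a, V n b & x = a / b]].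
(* Intersecting only the [W k] with [k < n] makes the sequence decreasing and its term at [0] the
   whole group. *)
exists (fun n => [set x | forall k, k < n -> W k x]); split.
- by apply/seteqP; split.
- elim=> [|n IHn]; first by apply: flat_nbhsS flat_nbhsT.
  have Wn : flat_nbhs (W n) by exists (V n) => // a b Va Vb; exists a, b.
  apply: flat_nbhsS (flat_nbhsI IHn Wn) => x [Zx Wx] k.
  by rewrite ltnS leq_eqVlt => /predU1P[->//|]; exact: Zx.
- move=> U [A]; rewrite nbhsB => -[b Bb bA] AU.
  exists (f b).+1 => m bm x /(_ _ bm)[c [d [Vc Vd ->]]].
  by apply: AU; apply: bA; [exact: Vc|exact: Vd].
Qed.

(** * Flat closure and flat density *)

Definition flat_closure H :=
  [set g | forall W, flat_nbhs W -> exists2 w, W w & H (g * w)].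

Lemma sub_flat_closure H : H `<=` flat_closure H.
Proof. by move=> g Hg W /flat_nbhs1 W1; exists 1; rewrite ?mulg1. Qed.

Lemma flat_closureS H H' : H `<=` H' -> flat_closure H `<=` flat_closure H'.
Proof. by move=> HH' g Hg W /Hg[w Ww Hw]; exists w => //; exact: HH'. Qed.

Lemma flat_closure_subgroup H :
  group_closed [in H] -> group_closed [in flat_closure H].
Proof.
move=> HH; apply: group_closedP => [|g h Hg Hh W Wf].
  by apply: sub_flat_closure; exact: subgroup1.
(* Conjugation by [h] is needed to bring the error [u / v] of [(g * u) / (h * v)] to the right of
   [g / h]. *)
have [W' W'f W'W] := flat_nbhsF (flat_nbhsJ h Wf).
have [u W'u Hu] := Hg _ W'f; have [v W'v Hv] := Hh _ W'f.
exists (h * (u / v) / h); first exact: W'W.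
have -> : g / h * (h * (u / v) / h) = (g * u) / (h * v).
  by rewrite !invgM -!mulgA mulKg.
exact: subgroupF.
Qed.

Lemma flat_dense H : flat_closure H = setT -> dense H.
Proof.
move=> HT O [o Oo] Oop.
have [g Og] := nbhs_flat_nbhs (open_nbhs_nbhs (conj Oop Oo)).
have Hg : flat_closure H g by rewrite HT.
have [w Ow Hw] := Hg _ Og.
by exists (g * w).
Qed.

(** * The flat-precompact case *)

Definition flat_precompact := forall W, flat_nbhs W ->
  exists2 F : set G, finite_set F & forall g, exists2 f, F f & W (f^-1 * g).

Lemma flat_precompactW : flat_precompact -> precompact_group G.
Proof.
move=> Gpc U /nbhs_flat_nbhs[g /Gpc[F Ffin FG]].
exists [set f / g | f in F]; first exact: finite_image.
apply/seteqP; split => // h _; have [f Ff Uh] := FG h.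
exists (f / g); first by exists f.
by exists (g * (f^-1 * h)) => //; rewrite -mulgA mulKg mulVKg.
Qed.

Lemma flat_precompact_subset W Z : flat_precompact -> flat_nbhs W ->
  exists F : set G, [/\ finite_set F, F `<=` Z &
    forall z, Z z -> exists2 f, F f & W (f^-1 * z)].
Proof.
move=> Gpc /flat_nbhsVM[W' W'f W'W]; have [E Efin EG] := Gpc _ W'f.
pose p e := xget 1 [set z | Z z /\ W' (e^-1 * z)].
(* Each center [e] is moved to a point of [Z] in [e W']. If there is none, [p e] is the default [1],
   possibly outside [Z], hence the intersection. *)
exists ((p @` E) `&` Z); split; first exact/finite_setIl/finite_image.
  by move=> z [].
move=> z Zz; have [e Ee W'z] := EG z.
have [Zp W'p] : Z (p e) /\ W' (e^-1 * p e).
  exact: (@xgetI _ 1 [set z | Z z /\ W' (e^-1 * z)] z).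
exists (p e); first by split => //; exists e.
have -> : (p e)^-1 * z = (e^-1 * p e)^-1 * (e^-1 * z).
  by rewrite invgM invgK -mulgA mulVKg.
exact: W'W.
Qed.

Lemma flat_precompact_suitable_set : hausdorff_space G ->
  first_countable_space G -> flat_precompact -> exists S : set G, suitable_set S.
Proof.
move=> T2 /flat_countable_base[Z [Z0 Zf ZW]] Gpc.
have T1 := @hausdorff_accessible G T2.
have /choice[F FP] n := flat_precompact_subset (Z n) Gpc (Zf n.+1).
(* The sets [F n] shrink to [1], so [1] might not be isolated in their union. *)
pose S := (\bigcup_n F n) `\ 1.
have Sfin y : y != 1 -> locally_finite_at (S `|` [set 1]) y.
  move=> /(flat_nbhs_hausdorff T2)[W /flat_nbhsF[W' W'f W'W] nWy].
  have [n nW'] := ZW _ W'f.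
  (* For [m >= n], [F m] lies in [W']. A common point [x] of [W'] and [y W'] would put [y] in
     [W' W'^-1], hence in [W], so only the [F m] with [m < n] meet [y W']. *)
  exists [set x | W' (y^-1 * x)]; first exact: (flat_nbhs_translate y W'f).
  rewrite setIUr finite_setU; split; last first.
    by apply: sub_finite_set (finite_set1 1) => x [].
  apply: (@sub_finite_set _ _ (\bigcup_(m in `I_n) F m)); last first.
    by apply: bigcup_finite => [|m _]; [exact: finite_II|case: (FP m)].
  move=> x [/= W'x [[m _ Fmx] _]]; exists m => //=; rewrite ltnNge.
  apply/negP => nm; apply: nWy; have -> : y = x / (y^-1 * x).
    by rewrite invgM invgK mulVKg.
  by apply: W'W => //; apply: (nW' _ nm); have [_ + _] := FP m; apply.
exists S; split.
- apply: locally_finite_discrete => // y Sy.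
  have [|N Ny Nfin] := Sfin y; first by apply/eqP => y1; case: Sy.
  exists N => //; apply: sub_finite_set Nfin.
  exact: setIS (@subsetUl _ _ _).
- apply: locally_finite_closed => // y nSy; apply: Sfin.
  by apply/eqP => y1; apply: nSy; right.
- set H := generated_subgroup S.
  have HH : group_closed [in H] := generated_subgroup_closed S.
  have FH n f : F n f -> H f.
    move=> Ff; have [->|/eqP f1] := eqVneq f 1; first exact: subgroup1.
    by apply: sub_generated_subgroup; split => //; exists n.
  (* Successive approximation: the remainder [h^-1 * g] in [Z n] is corrected by an element of
     [F n]. *)
  have ZH g n : exists2 h, H h & Z n (h^-1 * g).
    elim: n => [|n [h Hh Zg]]; first by exists 1; [exact: subgroup1|rewrite Z0].
    have [_ _ /(_ _ Zg)[f Ff Zfg]] := FP n.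
    exists (h * f); first exact: (subgroupM HH Hh (FH _ _ Ff)).
    by rewrite invgM -mulgA.
  apply: flat_dense; apply/seteqP; split => // g _ W /flat_nbhsV/ZW[n nW].
  have [h Hh /(nW _ (leqnn n)) Wh] := ZH g n.
  exists (g^-1 * h); last by rewrite mulVKg.
  by move: Wh; rewrite /= invgM invgK.
Qed.

(** * The case that is not flat-precompact *)

Lemma separable_flat_nbhs W : locally_separable_space G -> flat_nbhs W ->
  exists D : set G, [/\ countable D, D `<=` W &
    flat_nbhs (flat_closure (generated_subgroup D))].
Proof.
move=> /(_ 1)[U U1 [D Dc Ddense]] Wf.
pose D' := [set val d | d in D] `&` W.
exists D'; split; first 2 last.
- set M := flat_closure _.
  have MM : group_closed [in M].
    exact/flat_closure_subgroup/generated_subgroup_closed.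
  pose O := (U `&` W)°.
  (* The points of [D'] are dense in the open set [O], even for the original topology. *)
  have OM : O `<=` M.
    move=> o Oo C /(flat_nbhs_translate o) Co.
    pose A := [set x | C (o^-1 * x)]° `&` O.
    have Ao : A o by split.
    have Aop : open A by apply: openI; exact: open_interior.
    have Uo : U o by have [] := interior_subset Oo.
    have [|d [Ad Dd]] :=
      Ddense [set u | A (val u)] _ (ex_intro2 _ _ A Aop erefl).
      by exists (SigSub (mem_set Uo)).
    have [/interior_subset Cd /interior_subset[_ Wd]] := Ad.
    exists (o^-1 * val d) => //; rewrite mulVKg.
    by apply: sub_generated_subgroup; split => //; exists d.
  have O1 : nbhs 1 O.
    by apply: nbhs_interior; apply: filterI => //; exact: flat_nbhs_nbhs.
  (* [O] need not be a flat neighborhood of [1], but it contains a flat open translate's worth of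
     points around some [g]; dividing by [g], which is in [M], brings them back to [1]. *)
  have [g Og] := nbhs_flat_nbhs O1.
  apply: flat_nbhsS (Og) => w /OM Mgw.
  have Mg : M g by apply: OM; rewrite -(mulg1 g); exact: flat_nbhs1 Og.
  by rewrite -(mulKg g w); exact: (subgroupM MM (subgroupV MM Mg) Mgw).
- apply: sub_countable Dc; apply: card_le_trans (card_image_le val D).
  by apply: subset_card_le => x [].
- by move=> x [].
Qed.

(** Greedy choice: each term avoids the translates of [W0] by all earlier terms, while two terms in
    one translate of [W] would differ by an element of [W^-1 W], a subset of [W0]. *)
Lemma flat_separated_seq : ~ flat_precompact -> exists (x : nat -> G) W,
  flat_nbhs W /\
  forall y m n, W (y^-1 * x m) -> W (y^-1 * x n) -> m = n.
Proof.
move=> /existsNP[W0 /not_implyP[W0f nF]].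
have /choice[h hP] (s : seq G) :
    exists g, forall f, f \in s -> ~ W0 (f^-1 * g).
  apply: contrapT => ns; apply: nF; exists [set` s]; first exact: finite_seq.
  move=> g; apply: contrapT => ng; apply: ns; exists g => f fs W0f'.
  by apply: ng; exists f.
(* [l n] holds the first [n] terms, and [h (l n)] is the next one. *)
pose l n := iter n (fun s => h s :: s) [::].
have lP m n : m < n -> h (l m) \in l n.
  elim: n => // n IHn; rewrite ltnS leq_eqVlt inE => /predU1P[->|/IHn ->].
    by rewrite eqxx.
  by rewrite orbT.
have [W Wf WW0] := flat_nbhsVM W0f.
exists (h \o l), W; split => // y.
have lt m n : m < n -> W (y^-1 * h (l m)) -> ~ W (y^-1 * h (l n)).
  move=> mn Wm Wn; apply: (hP (l n) _ (lP _ _ mn)).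
  have -> : (h (l m))^-1 * h (l n) = (y^-1 * h (l m))^-1 * (y^-1 * h (l n)).
    by rewrite invgM invgK -mulgA mulVKg.
  exact: WW0.
move=> m n Wm Wn; case: (ltngtP m n) => // mn; exfalso.
  exact: lt mn Wm Wn.
exact: lt mn Wn Wm.
Qed.

Lemma not_flat_precompact_closed_suitable_set : hausdorff_space G ->
  locally_separable_space G -> ~ flat_precompact ->
  exists S : set G, closed_suitable_set S.
Proof.
move=> T2 Gls /flat_separated_seq[x [W2 [W2f xW2]]].
have T1 := @hausdorff_accessible G T2.
have [W1 W1f W1W2] := flat_nbhsF W2f.
have [D [/countable_injP[i iinj] DW1]] := separable_flat_nbhs Gls W1f.
set P := generated_subgroup D; set M := flat_closure P => Mf.
have PP : group_closed [in P] := generated_subgroup_closed D.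
have MM : group_closed [in M] := flat_closure_subgroup PP.
have [T [TG TM]] := transversal_exists MM.
pose S := T `|` (range x `|` [set x (i d) * d | d in D]).
have finite_subsingleton (A : set G) :
    {in A &, forall a b, a = b} -> finite_set A.
  move=> A1; have [->|/set0P[a Aa]] := eqVneq A set0; first exact: finite_set0.
  by apply: sub_finite_set (finite_set1 a) => b Ab; apply: A1; exact: mem_set.
have Sfin y : locally_finite_at S y.
  (* Each of the three pieces of [S] has at most one point here: [y M] is a single coset, and [y W1]
     controls the other two. *)
  exists ([set z | M (y^-1 * z)] `&` [set z | W1 (y^-1 * z)]).
    by apply: filterI; [exact: (flat_nbhs_translate y Mf)|
      exact: (flat_nbhs_translate y W1f)].
  rewrite /S !setIUr !finite_setU; split; last split.
  - apply: finite_subsingleton => a b /set_mem[[/= Ma _] Ta].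
    move=> /set_mem[[/= Mb _] Tb].
    apply: TM; [exact: mem_set|exact: mem_set|].
    have -> : a^-1 * b = (y^-1 * a)^-1 * (y^-1 * b).
      by rewrite invgM invgK -mulgA mulVKg.
    exact: (subgroupM MM (subgroupV MM Ma) Mb).
  - apply: finite_subsingleton => a b /set_mem[[_ /= Wa] [m _ ma]].
    move=> /set_mem[[_ /= Wb] [n _ nb]]; subst a b; congr x; apply: (xW2 y).
      by rewrite -(divg1 (_ * _)); apply: W1W2 => //; exact: (flat_nbhs1 W1f).
    by rewrite -(divg1 (_ * _)); apply: W1W2 => //; exact: (flat_nbhs1 W1f).
  - apply: finite_subsingleton => a b /set_mem[[_ /= Wa] [d Dd da]].
    move=> /set_mem[[_ /= Wb] [e De eb]]; subst a b.
    suff -> : d = e by [].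
    (* Since [d] is in [W1], removing it from [x (i d) * d] in [y W1] leaves [x (i d)] in
       [y W1 W1^-1], hence in [y W2]. *)
    apply: iinj; [exact: mem_set|exact: mem_set|apply: (xW2 y)].
      by rewrite -(mulgK d (_ * _)) -(mulgA y^-1); apply: W1W2 => //; exact: DW1.
    by rewrite -(mulgK e (_ * _)) -(mulgA y^-1); apply: W1W2 => //; exact: DW1.
have Scl : closed S by apply: locally_finite_closed.
exists S; split => //; split.
- exact: locally_finite_discrete.
- by apply: closedU => //; exact: accessible_closed_set1.
- set H := generated_subgroup S.
  have HH : group_closed [in H] := generated_subgroup_closed S.
  have cHH := flat_closure_subgroup HH.
  have SH : S `<=` H := @sub_generated_subgroup _ S.
  have PH : P `<=` H.
    (* [D] itself may accumulate, but each [d] is recovered from the two points [x (i d)] and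
       [x (i d) * d] of [S]. *)
    apply: generated_subgroup_sub => // d Dd; rewrite -(mulKg (x (i d)) d).
    apply: (subgroupM HH); first apply: (subgroupV HH).
      by apply: SH; right; left; exists (i d).
    by apply: SH; right; right; exists d.
  apply: flat_dense; apply/seteqP; split => // g _.
  have [t Tt Mg] := TG g.
  rewrite -(mulVKg t g); apply: (subgroupM cHH).
    by apply: sub_flat_closure; apply: SH; left.
  exact: flat_closureS PH _ Mg.
Qed.

End FlatTopology.

Theorem corollary4p6 (G : paratopologicalGroupType) :
  hausdorff_space G -> locally_separable_space G -> saturated G ->
  first_countable_space G ->
  (exists S : set G, suitable_set S) /\
  (~ precompact_group G -> exists S : set G, closed_suitable_set S).
Proof.
move=> T2 Gls Gsat G1.
have [Gpc|nGpc] := pselect (flat_precompact G); split.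
- exact: flat_precompact_suitable_set.
- by move=> /(_ (flat_precompactW Gsat Gpc)).
- have [S [Ss _]] := not_flat_precompact_closed_suitable_set Gsat T2 Gls nGpc.
  by exists S.
- by move=> _; exact: not_flat_precompact_closed_suitable_set.
Qed.
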